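(* Let $S$ be a Damek--Ricci space in the half-space model. Let $\gamma$ be the prolongation of the unit speed geodesic starting from $e$ with unit initial velocity $(v,z,s)\in T_eS$, let $p=(\bar V,\bar Z,\bar t)\in S$, let $\eta=L_p\circ\gamma$, and let $\hat\eta(t)=\eta(\tanh(t/2))$ be the corresponding unit speed geodesic starting from $p$. If $z=0$, then the quartic hypersurfaces $\tilde\Sigma_\theta^{\hat\eta}$ tend to the hypersurface defined by the quadratic equation $$\frac1t\left(\left(2s\sqrt{\bar t}-\langle V-\bar V,v\rangle\right)^2+\big\|[V-\bar V,v]\big\|^2\right)=4s^2$$ as $\theta$ tends to $1/s$ in $\mathbb R\mathbf P^1$ (where $1/s=\infty$ if $s=0$).
   Context: Damek--Ricci space: let $\mathfrak s=\mathfrak v\oplus\mathfrak z\oplus\mathfrak a$ be an orthogonal decomposition of a finite-dimensional Euclidean space $(\mathfrak s,\langle\,,\rangle)$ with $\mathfrak a=\mathbb RA$, $\|A\|=1$, $n=\dim\mathfrak v$, $m=\dim\mathfrak z$ (either may be $0$). Let $J$ be a representation on $\mathfrak v$ of the Clifford algebra $\mathrm{Cl}(\mathfrak z,q)$ of $q(Z)=-\langle Z,Z\rangle$ with $\|J_ZV\|=\|Z\|\|V\|$. The Lie bracket on $\mathfrak s$ is determined by $\langle[U,V],Z\rangle=\langle J_ZU,V\rangle$ with $[U,V]\in\mathfrak z$ for $U,V\in\mathfrak v$, $Z\in\mathfrak z$; $[\mathfrak v\oplus\mathfrak z,\mathfrak z]=0$; $[A,V]=\frac12V$ for $V\in\mathfrak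 v$; $[A,Z]=Z$ for $Z\in\mathfrak z$. The simply connected Lie group $S$ with Lie algebra $\mathfrak s$ and the left-invariant metric induced by $\langle\,,\rangle$ is the Damek--Ricci space. Half-space model: $S$ is identified with $\mathfrak v\oplus\mathfrak z\times\mathbb R_+\subset\mathfrak v\oplus\mathfrak z\oplus\mathbb R\cong\mathfrak s$ via $(V,Z,t)\mapsto\exp(V+Z)\exp((\ln t)A)$; $e=(0,0,1)$; $(v,z,s)\in T_eS$ means $v+z+sA$. The left translation by $(\bar V,\bar Z,\bar t)\in S$ extends to the affine map $L_{(\bar V,\bar Z,\bar t)}(V,Z,t)=(\bar V+\sqrt{\bar t}V,\ \bar Z+\bar tZ+\frac12\sqrt{\bar t}[\bar V,V],\ \bar tt)$ of $\mathfrak v\oplus\mathfrak z\oplus\mathbb R$ and to the projective closure $\mathbf P(\mathfrak s\oplus\mathbb R)$ of $\mathfrak s$. Prolongation: for a unit vector $(v,z,s)\in T_eS$ the unit speed geodesic from $e$ with this initial velocity is $\hat\gamma(t)=\gamma(\tanh(t/2))$, where $\gamma(\theta)=\left(\frac{2\theta(1-s\theta)}{\chi(\theta)}v+\frac{2\theta^2}{\chi(\theta)}J_zv,\frac{2\theta}{\chi(\theta)}z,\frac{1-\theta^2}{\chi(\theta)}\right)$, $\chi(\theta)=(1-s\theta)^2+\|z\|^2\theta^2$; its prolongation is the continuous extension $\gamma\colon\mathbb R\mathbf P^1\to\mathbf P(\mathfrak s\oplus\mathbb R)$. For $x_0=(V_0,Z_0,t_0)\in\mathfrak v\oplus\mathfrak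 z\oplus\mathbb R$ let $D_{x_0}((V,Z,t))=\frac1t\left(\left(t+t_0+\left\|\frac{V-V_0}{2}\right\|^2\right)^2+\left\|Z-Z_0+\frac12[V,V_0]\right\|^2\right)$. For $\theta\in\mathbb R\mathbf P^1$ such that $\eta(\theta)$ is not a point at infinity, $\tilde\Sigma_\theta^{\hat\eta}$ is the hypersurface with equation $D_{\eta(\theta)}(x)=D_{\eta(\theta)}(p)$, viewed (after multiplication by $t$) as an algebraic hypersurface of degree at most $4$ in $(V,Z,t)$. Convergence: non-trivial polynomial equations of degree at most $4$ on $\mathfrak v\oplus\mathfrak z\oplus\mathbb R$, up to non-zero constant multiples, form a projective space with its natural topology. Hypersurfaces $\tilde\Sigma_\theta^{\hat\eta}$ tend to a hypersurface $\tilde\Sigma$ if their equations tend to the equation of $\tilde\Sigma$ in this projective space (the displayed limit equation is likewise multiplied by $t$). *)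

(* Defs.v *)
From HB Require Import structures.
(* the notations of mpoly are incompatible with those of mathcomp-analysis *)
From mathcomp Require Import -(notations) mpoly.
From mathcomp Require Import all_boot all_order all_algebra.
From mathcomp Require Import boolp classical_sets functions reals topology normedtype.
From mathcomp Require Import ring lra.

Set Implicit Arguments.
Unset Strict Implicit.
Unset Printing Implicit Defensive.

Import Order.TTheory GRing.Theory Num.Theory.
Import numFieldNormedType.Exports.

Local Open Scope classical_set_scope.
Local Open Scope ring_scope.
Local Open Scope quotient_scope.

Section Projective.
Context {R : realType} (W : normedModType R).

Definition nonzero : set W := [set w | w != 0].

Definition proportional (w w' : nonzero) : bool :=
  `[< exists2 c : R, c != 0 & set_val w' = c *: set_val w >].

Lemma proportional_refl : reflexive proportional.
Proof. by move=> w; apply/asboolP; exists 1; rewrite ?oner_eq0// scale1r. Qed.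

Lemma proportional_sym : symmetric proportional.
Proof.
suff H w w' : proportional w w' -> proportional w' w.
  by move=> w w'; apply/idP/idP; exact: H.
move=> /asboolP[c c0 e]; apply/asboolP; exists c^-1; first by rewrite invr_eq0.
by rewrite e scalerA mulVf// scale1r.
Qed.

Lemma proportional_trans : transitive proportional.
Proof.
move=> w2 w1 w3 /asboolP[c c0 e] /asboolP[d d0 f]; apply/asboolP.
by exists (d * c); rewrite ?mulf_neq0// f e scalerA.
Qed.

Canonical proportional_equiv :=
  EquivRel proportional proportional_refl proportional_sym proportional_trans.

Definition projective_space : Type :=
  quotient_topology {eq_quot proportional_equiv}.

HB.instance Definition _ := Topological.on projective_space.
HB.instance Definition _ := Quotient.on projective_space.

Definition pclass (w : W) (w0 : w != 0) : projective_space :=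
  \pi_projective_space (exist _ w (mem_set w0) : nonzero).

Definition prepr (P : projective_space) : W := set_val (repr P).

Lemma prepr_neq0 (P : projective_space) : prepr P != 0.
Proof. exact: (set_valP (repr P)). Qed.

Lemma preprK (P : projective_space) : pclass (prepr_neq0 P) = P.
Proof.
rewrite /pclass -[RHS]reprK; congr (\pi_projective_space _); exact/val_inj.
Qed.

Lemma pclass_eqP (w w' : W) (w0 : w != 0) (w0' : w' != 0) :
  pclass w0 = pclass w0' <-> exists2 c : R, c != 0 & w' = c *: w.
Proof.
by split=> [/(@eqmodP _ proportional_equiv)/asboolP[c c0 e]|[c c0 e]];
  [exists c | apply/(@eqmodP _ proportional_equiv)/asboolP; exists c].
Qed.

Lemma prepr_pclass (w : W) (w0 : w != 0) :
  exists2 c : R, c != 0 & prepr (pclass w0) = c *: w.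
Proof. by apply/(pclass_eqP w0 (prepr_neq0 _)); rewrite preprK. Qed.

End Projective.

Section RealProjectiveLine.
Context {R : realType}.

Definition rp1 : Type := projective_space (R * R)%type.
HB.instance Definition _ := Topological.on rp1.

Lemma rp1_of_neq0 (a : R) : (a, 1) != 0 :> R * R.
Proof. by apply/eqP => -[_ /eqP]; rewrite oner_eq0. Qed.

Definition rp1_of (a : R) : rp1 := pclass (rp1_of_neq0 a).

Lemma rp1_infty_neq0 : (1, 0) != 0 :> R * R.
Proof. by apply/eqP => -[/eqP]; rewrite oner_eq0. Qed.

Definition rp1_infty : rp1 := pclass rp1_infty_neq0.

Definition rp1_inv (a : R) : rp1 :=
  if a == 0 then rp1_infty else rp1_of a^-1.

End RealProjectiveLine.
Arguments rp1 R : clear implicits.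

(* The library norm `|u| of a row vector is the sup norm, whence [enorm]. *)
Definition dot (K : comNzRingType) k (u v : 'rV[K]_k) : K :=
  \sum_i u 0 i * v 0 i.
Definition normsq (K : comNzRingType) k (u : 'rV[K]_k) : K := dot u u.
Definition enorm (R : realType) k (u : 'rV[R]_k) : R := Num.sqrt (normsq u).

(* By the universal property of the Clifford algebra, a representation of
   Cl(z, q), q(Z) = - <Z, Z>, on v amounts to a linear map J : z -> End(v) such
   that J_Z^2 = q(Z) id. Endomorphisms act on row vectors: J_Z V = V *m J Z. *)
Record clifford_module (R : realType) (n m : nat) := CliffordModule {
  cliff :> {linear 'rV[R]_m -> 'M[R]_n};
  cliff_sqr : forall Z, cliff Z *m cliff Z = (- normsq Z)%:M;
  cliff_norm : forall Z (V : 'rV[R]_n),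
    enorm (V *m cliff Z) = enorm Z * enorm V }.

Section DamekRicci.
Context {R : realType} {n m : nat} (J : clifford_module R n m).

(* v + z + R; a point is a triple (V, Z, t). *)
Definition point : Type := ('rV[R]_n * 'rV[R]_m * R)%type.
HB.instance Definition _ := NormedModule.on point.

Definition half_space : Type := {x : point | 0 < x.2}.

Definition bracket (U V : 'rV[R]_n) : 'rV[R]_m :=
  \row_k dot (U *m J (delta_mx 0 k)) V.

Lemma bracketP (U V : 'rV[R]_n) (W : 'rV[R]_m) :
  W = bracket U V <-> forall Z, dot W Z = dot (U *m J Z) V.
Proof.
have dotd (X : 'rV[R]_m) k : dot X (delta_mx 0 k) = X 0 k.
  rewrite /dot (bigD1 k)//= big1 ?addr0 => [|i ik].
    by rewrite mxE !eqxx mulr1.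
  by rewrite mxE (negPf ik) andbF mulr0.
split=> [-> Z|H]; last by apply/rowP => k; rewrite mxE -H dotd.
rewrite [in RHS](row_sum_delta Z) linear_sum /= mulmx_sumr.
rewrite {1}/dot [RHS]/dot.
under [RHS]eq_bigr => i _ do rewrite summxE mulr_suml.
rewrite exchange_big/=; apply: eq_bigr => k _; rewrite mxE /dot mulr_suml.
by apply: eq_bigr => i _; rewrite linearZ /= -scalemxAr [in RHS]mxE; ring.
Qed.

Definition left_transl (p : half_space) (x : point) : point :=
  let: (Vb, Zb, tb) := sval p in let: (V, Z, t) := x in
  (Vb + Num.sqrt tb *: V,
   Zb + tb *: Z + (2^-1 * Num.sqrt tb) *: bracket Vb V,
   tb * t).

(* P(s + R); the point x of s is [x : 1], and b = 0 is the hyperplane at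
   infinity. *)
Definition proj_closure : Type := projective_space (point * R)%type.
HB.instance Definition _ := Topological.on proj_closure.

Lemma embed_neq0 (x : point) : (x, 1) != 0 :> point * R.
Proof. by apply/eqP => -[_ /eqP]; rewrite oner_eq0. Qed.

Definition embed (x : point) : proj_closure := pclass (embed_neq0 x).

(* Junk value 0 at the points at infinity. *)
Definition affine_coords (P : proj_closure) : point :=
  (prepr P).2^-1 *: (prepr P).1.

Lemma embedK : cancel embed affine_coords.
Proof.
move=> x; rewrite /affine_coords.
have [c c0 ->] := prepr_pclass (embed_neq0 x).
by rewrite /= [c *: 1]mulr1 scalerA mulVf// scale1r.
Qed.

(* The linear lift of [left_transl p] to s + R. *)
Definition left_transl_lift (p : half_space) (w : point * R) : point * R :=
  let: (Vb, Zb, tb) := sval p in let: (V, Z, t, b) := w in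
  (b *: Vb + Num.sqrt tb *: V,
   b *: Zb + tb *: Z + (2^-1 * Num.sqrt tb) *: bracket Vb V,
   tb * t, b).

Lemma left_transl_lift_neq0 p w : w != 0 -> left_transl_lift p w != 0.
Proof.
case: p => -[[Vb Zb] tb] /= tb0; case: w => -[[V Z] t] b.
apply: contraNneq; rewrite /left_transl_lift/=.
move=> -[+ + /eqP + b0]; rewrite {}b0 mulf_eq0 gt_eqF//= => + + /eqP ->.
rewrite scale0r add0r => /eqP; rewrite scaler_eq0 gt_eqF ?sqrtr_gt0//=.
move=> /eqP ->; have -> : bracket Vb 0 = 0.
  by apply/rowP => k; rewrite !mxE /dot big1// => i _; rewrite [X in _ * X]mxE mulr0.
rewrite scaler0 addr0 scale0r add0r => /eqP; rewrite scaler_eq0 gt_eqF//=.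
by move=> /eqP ->.
Qed.

Definition proj_left_transl (p : half_space) (P : proj_closure) :
    proj_closure :=
  pclass (left_transl_lift_neq0 p (prepr_neq0 P)).

Lemma left_transl_liftZ p c w :
  left_transl_lift p (c *: w) = c *: left_transl_lift p w.
Proof.
case: p => -[[Vb Zb] tb] /= tb0; case: w => -[[V Z] t] b.
have -> : c *: (V, Z, t, b) = (c *: V, c *: Z, c * t, c * b) by [].
rewrite /left_transl_lift/=.
have -> : bracket Vb (c *: V) = c *: bracket Vb V.
  apply/rowP => k; rewrite !mxE /dot mulr_sumr; apply: eq_bigr => i _.
  by rewrite !mxE; ring.
congr (_, _, _, _).
- by rewrite /= scalerDr !scalerA [Num.sqrt tb * c]mulrC.
- by rewrite /= !scalerDr !scalerA [tb * c]mulrC [_ * c]mulrC.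
- by rewrite /= mulrCA.
Qed.

Lemma proj_left_transl_pclass p (w : point * R) (w0 : w != 0) :
  proj_left_transl p (pclass w0) = pclass (left_transl_lift_neq0 p w0).
Proof.
apply/esym/pclass_eqP; have [c c0 e] := prepr_pclass w0.
by exists c => //; rewrite -left_transl_liftZ e.
Qed.

Lemma proj_left_transl_embed p x :
  proj_left_transl p (embed x) = embed (left_transl p x).
Proof.
rewrite proj_left_transl_pclass; apply/pclass_eqP; exists 1.
  exact: oner_neq0.
rewrite scale1r; case: p => -[[Vb Zb] tb] /= tb0; case: x => -[V Z] t.
by rewrite /left_transl/left_transl_lift /= !scale1r.
Qed.

Definition unit_vector (v : 'rV[R]_n) (z : 'rV[R]_m) (s : R) : Prop :=
  normsq v + normsq z + s ^+ 2 = 1.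

Definition chi (z : 'rV[R]_m) (s theta : R) : R :=
  (1 - s * theta) ^+ 2 + normsq z * theta ^+ 2.

(* [geodesic_param v z s (tanh (t / 2))] is the point with parameter t on the
   unit speed geodesic from (0, 0, 1) with initial velocity v + z + s A. *)
Definition geodesic_param (v : 'rV[R]_n) (z : 'rV[R]_m) (s theta : R) : point :=
  ((2 * theta * (1 - s * theta) / chi z s theta) *: v
     + (2 * theta ^+ 2 / chi z s theta) *: (v *m J z),
   (2 * theta / chi z s theta) *: z,
   (1 - theta ^+ 2) / chi z s theta).

(* [geodesic_param v z s] is defined off the zeros of chi, of which there are
   finitely many, so that its continuous extension to the projective line is
   unique. *)
Definition is_prolongation (v : 'rV[R]_n) (z : 'rV[R]_m) (s : R)
    (gamma : rp1 R -> proj_closure) : Prop :=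
  continuous gamma /\
  forall theta, chi z s theta != 0 ->
    gamma (rp1_of theta) = embed (geodesic_param v z s theta).

Definition damek (x0 x : point) : R :=
  let: (V0, Z0, t0) := x0 in let: (V, Z, t) := x in
  t^-1 * ((t + t0 + normsq (2^-1 *: (V - V0))) ^+ 2
          + normsq (Z - Z0 + 2^-1 *: bracket V V0)).

Definition limit_lhs (v : 'rV[R]_n) (s : R) (p x : point) : R :=
  let: (Vb, Zb, tb) := p in let: (V, Z, t) := x in
  t^-1 * ((2 * s * Num.sqrt tb - dot (V - Vb) v) ^+ 2
          + normsq (bracket (V - Vb) v)).

(* Polynomials on v + z + R; the variables are the coordinates of V, then those
   of Z, then t. *)
Definition nvars := (n + m + 1)%N.
Local Notation poly := (mpoly nvars R).
Local Notation C := (@mpolyC nvars R).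

Definition coords (x : point) (i : 'I_nvars) : R :=
  row_mx (row_mx x.1.1 x.1.2) x.2%:M 0 i.

Definition allX : 'rV[poly]_nvars := \row_i mpolyX R (mnm1 i).
Definition varV : 'rV[poly]_n := lsubmx (lsubmx allX).
Definition varZ : 'rV[poly]_m := rsubmx (lsubmx allX).
Definition vart : poly := rsubmx allX 0 0.

Definition bracket_poly (U V : 'rV[poly]_n) : 'rV[poly]_m :=
  \row_k dot (U *m map_mx C (J (delta_mx 0 k))) V.

(* t (D_{x0}(x) - D_{x0}(p)) as a polynomial in x = (V, Z, t). *)
Definition sigma_poly (x0 p : point) : poly :=
  let: (V0, Z0, t0) := x0 in
  (vart + C t0 + normsq (C 2^-1 *: (varV - map_mx C V0))) ^+ 2
  + normsq (varZ - map_mx C Z0 + C 2^-1 *: bracket_poly varV (map_mx C V0))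
  - C (damek x0 p) * vart.

Definition limit_poly (v : 'rV[R]_n) (s : R) (p : point) : poly :=
  let: (Vb, Zb, tb) := p in
  (C (2 * s * Num.sqrt tb) - dot (varV - map_mx C Vb) (map_mx C v)) ^+ 2
  + normsq (bracket_poly (varV - map_mx C Vb) (map_mx C v))
  - C (4 * s ^+ 2) * vart.

Lemma meval_dot (x : point) k (U V : 'rV[poly]_k) :
  meval (coords x) (dot U V)
  = dot (map_mx (meval (coords x)) U) (map_mx (meval (coords x)) V).
Proof.
by rewrite /dot raddf_sum; apply: eq_bigr => i _; rewrite /= mevalM !mxE.
Qed.

Lemma meval_bracket (x : point) (U V : 'rV[poly]_n) :
  map_mx (meval (coords x)) (bracket_poly U V)
  = bracket (map_mx (meval (coords x)) U) (map_mx (meval (coords x)) V).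
Proof.
apply/rowP => k; rewrite !mxE meval_dot; congr dot.
rewrite map_mxM; congr (_ *m _).
by apply/matrixP => i j; rewrite !mxE; exact: mevalC.
Qed.

Lemma meval_const (x : point) k l (A : 'M[R]_(k, l)) :
  map_mx (meval (coords x)) (map_mx C A) = A.
Proof. by apply/matrixP => i j; rewrite !mxE; exact: mevalC. Qed.

Lemma meval_allX (x : point) :
  map_mx (meval (coords x)) allX = row_mx (row_mx x.1.1 x.1.2) x.2%:M.
Proof. by apply/rowP => i; rewrite !mxE mevalXU /coords mxE. Qed.

Lemma meval_varV (x : point) : map_mx (meval (coords x)) varV = x.1.1.
Proof. by rewrite /varV !map_lsubmx meval_allX !row_mxKl. Qed.

Lemma meval_varZ (x : point) : map_mx (meval (coords x)) varZ = x.1.2.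
Proof. by rewrite /varZ map_rsubmx map_lsubmx meval_allX row_mxKl row_mxKr. Qed.

Lemma meval_vart (x : point) : meval (coords x) vart = x.2.
Proof.
have -> : meval (coords x) vart = map_mx (meval (coords x)) (rsubmx allX) 0 0.
  by rewrite mxE.
by rewrite map_rsubmx meval_allX row_mxKr mxE eqxx.
Qed.

Lemma meval_mxD (x : point) k l (A B : 'M[poly]_(k, l)) :
  map_mx (meval (coords x)) (A + B)
  = map_mx (meval (coords x)) A + map_mx (meval (coords x)) B.
Proof. exact: map_mxD. Qed.

Lemma meval_mxB (x : point) k l (A B : 'M[poly]_(k, l)) :
  map_mx (meval (coords x)) (A - B)
  = map_mx (meval (coords x)) A - map_mx (meval (coords x)) B.
Proof. exact: map_mxB. Qed.

Lemma meval_mxZ (x : point) k l (c : R) (A : 'M[poly]_(k, l)) :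
  map_mx (meval (coords x)) (C c *: A) = c *: map_mx (meval (coords x)) A.
Proof. by rewrite -[in RHS](mevalC (coords x) c); exact: map_mxZ. Qed.

Lemma sigma_polyP (x0 p x : point) : x.2 != 0 ->
  meval (coords x) (sigma_poly x0 p) = x.2 * (damek x0 x - damek x0 p).
Proof.
move=> t0; case: x0 => -[V0 Z0] s0; rewrite /sigma_poly.
rewrite mevalB mevalM mevalC meval_vart mevalD !expr2 mevalM !mevalD mevalC.
rewrite meval_vart /normsq !meval_dot meval_mxD !meval_mxZ !meval_mxB.
rewrite meval_varV meval_varZ meval_bracket !meval_const meval_varV.
case: x t0 => -[V Z] t /= t0; rewrite mulrBr; congr (_ - _); last by rewrite mulrC.
by rewrite mulVKf// expr2.
Qed.

Lemma limit_polyP (v : 'rV[R]_n) (s : R) (p x : point) : x.2 != 0 ->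
  meval (coords x) (limit_poly v s p)
  = x.2 * (limit_lhs v s p x - 4 * s ^+ 2).
Proof.
move=> t0; case: p => -[Vb Zb] tb; rewrite /limit_poly.
rewrite mevalB [X in _ - X]mevalM mevalC meval_vart mevalD !expr2 mevalM !mevalB.
rewrite mevalC /normsq !meval_dot meval_bracket !meval_mxB.
rewrite !meval_const meval_varV.
by case: x t0 => -[V Z] t /= t0; rewrite /normsq; field.
Qed.

Let deg_le d (p : poly) := (mmeasure mdeg p <= d.+1)%N.

Lemma deg_leD d p q : deg_le d p -> deg_le d q -> deg_le d (p + q).
Proof.
move=> hp hq; apply: leq_trans (msizeD_le _ _) _.
by rewrite geq_max; apply/andP.
Qed.

Lemma deg_leN d p : deg_le d p -> deg_le d (- p).
Proof. by rewrite /deg_le mmeasureN. Qed.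

Lemma deg_leM d e p q : deg_le d p -> deg_le e q -> deg_le (d + e) (p * q).
Proof.
rewrite /deg_le => hp hq; have [->|p0] := eqVneq p 0.
  by rewrite mul0r mmeasure0.
have [->|q0] := eqVneq q 0; first by rewrite mulr0 mmeasure0.
rewrite msizeM//; have := leq_add hp hq; rewrite addSn addnS.
by case: (_ + _)%N.
Qed.

Lemma deg_leC d c : deg_le d (C c).
Proof. by rewrite /deg_le mmeasureC; case: (_ != 0). Qed.

Lemma deg_le_sum d k (F : 'I_k -> poly) :
  (forall i, deg_le d (F i)) -> deg_le d (\sum_i F i).
Proof.
move=> h; elim/big_ind: _ => //; last exact: deg_leD.
by rewrite -(mpolyC0 nvars R); exact: deg_leC.
Qed.

Lemma deg_le_allX i : deg_le 1 (allX 0 i).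
Proof. by rewrite mxE /deg_le msizeX mdeg1. Qed.

Lemma deg_le_varV i : deg_le 1 (varV 0 i).
Proof. by rewrite mxE mxE; exact: deg_le_allX. Qed.

Lemma deg_le_varZ i : deg_le 1 (varZ 0 i).
Proof. by rewrite mxE mxE; exact: deg_le_allX. Qed.

Lemma deg_le_vart : deg_le 1 vart.
Proof. by rewrite /vart mxE; exact: deg_le_allX. Qed.

Lemma deg_le_dot d e k (U V : 'rV[poly]_k) : (forall i, deg_le d (U 0 i)) ->
  (forall i, deg_le e (V 0 i)) -> deg_le (d + e) (dot U V).
Proof. by move=> hU hV; apply: deg_le_sum => i; exact: deg_leM. Qed.

Lemma deg_le_const d k (A : 'rV[R]_k) i : deg_le d (map_mx C A 0 i).
Proof. by rewrite mxE; exact: deg_leC. Qed.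

Lemma deg_le_bracket (U : 'rV[poly]_n) (V : 'rV[R]_n) k :
  (forall i, deg_le 1 (U 0 i)) ->
  deg_le 1 (bracket_poly U (map_mx C V) 0 k).
Proof.
move=> hU; rewrite mxE; apply: (@deg_le_dot 1 0) => i; last exact: deg_le_const.
rewrite mxE; apply: deg_le_sum => j; apply: (@deg_leM 1 0) => //.
by rewrite mxE; exact: deg_leC.
Qed.

Lemma deg_le_varVB (V : 'rV[R]_n) i : deg_le 1 ((varV - map_mx C V) 0 i).
Proof.
rewrite mxE [X in _ + X]mxE; apply: deg_leD; first exact: deg_le_varV.
by apply: deg_leN; exact: deg_le_const.
Qed.

Lemma size_sigma_poly x0 p : (mmeasure mdeg (sigma_poly x0 p) <= 5)%N.
Proof.
have dZ k (U : 'rV[poly]_k) c i :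
    deg_le 1 (U 0 i) -> deg_le 1 ((C c *: U) 0 i).
  by move=> hU; rewrite mxE; apply: (@deg_leM 0 1) => //; exact: deg_leC.
have w2 q : deg_le 2 q -> deg_le 4 q by move=> h; exact: leq_trans h _.
have w1 q : deg_le 1 q -> deg_le 2 q by move=> h; exact: leq_trans h _.
case: x0 => -[V0 Z0] t0; rewrite /sigma_poly -/(deg_le 4 _).
apply: deg_leD; first apply: deg_leD.
- rewrite expr2; apply: (@deg_leM 2 2); apply: deg_leD;
  (try by apply: (@deg_le_dot 1 1) => i; apply: dZ; exact: deg_le_varVB);
  by apply: w1; apply: deg_leD; [exact: deg_le_vart|exact: deg_leC].
- apply: w2; apply: (@deg_le_dot 1 1) => i; rewrite mxE;
  (apply: deg_leD; last by apply: dZ; apply: deg_le_bracket; exact: deg_le_varV);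
  rewrite mxE [X in _ + X]mxE;
  (apply: deg_leD; [exact: deg_le_varZ|by apply: deg_leN; exact: deg_le_const]).
- apply: deg_leN; apply: w2; apply: w1;
  by apply: (@deg_leM 0 1); [exact: deg_leC|exact: deg_le_vart].
Qed.

Lemma size_limit_poly v s p : (mmeasure mdeg (limit_poly v s p) <= 5)%N.
Proof.
have w2 q : deg_le 2 q -> deg_le 4 q by move=> h; exact: leq_trans h _.
have w1 q : deg_le 1 q -> deg_le 2 q by move=> h; exact: leq_trans h _.
case: p => -[Vb Zb] tb; rewrite /limit_poly -/(deg_le 4 _).
apply: w2; apply: deg_leD; first apply: deg_leD.
- rewrite expr2; apply: (@deg_leM 1 1);
  (apply: deg_leD; first exact: deg_leC);
  apply: deg_leN; apply: (@deg_le_dot 1 0) => i;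
  by [exact: deg_le_varVB|exact: deg_le_const].
- by apply: (@deg_le_dot 1 1) => i; apply: deg_le_bracket => j;
  exact: deg_le_varVB.
- apply: deg_leN; apply: w1;
  by apply: (@deg_leM 0 1); [exact: deg_leC|exact: deg_le_vart].
Qed.

(* The space of polynomials of degree at most 4, as the space of their
   coefficients. *)
Definition nmonomials := #|{: bmultinom nvars 5}|.
Definition quartic_coefs (q : poly) : 'rV[R]_nmonomials :=
  \row_i mcoeff (enum_val i : bmultinom nvars 5) q.

Lemma quartic_coefs_neq0 (q : poly) :
  (mmeasure mdeg q <= 5)%N -> q != 0 -> quartic_coefs q != 0.
Proof.
move=> q5; apply: contraNneq => /rowP c0; apply/eqP/mpolyP => mm.
rewrite mcoeff0; have [mm5|mm5] := ltnP (mdeg mm) 5.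
  by have := c0 (enum_rank (BMultinom mm5)); rewrite !mxE enum_rankK.
by apply: memN_msupp_eq0; apply: msize_mdeg_ge; exact: leq_trans mm5.
Qed.

Definition quartic_equations : Type := projective_space 'rV[R]_nmonomials.
HB.instance Definition _ := Topological.on quartic_equations.

Lemma sigma_poly_neq0 x0 p : quartic_coefs (sigma_poly x0 p) != 0.
Proof.
apply: quartic_coefs_neq0; first exact: size_sigma_poly.
case: x0 => -[V0 Z0] t0; apply/eqP => q0.
pose c := normsq (Z0 - Z0 + 2^-1 *: bracket V0 V0).
have E t : t != 0 -> t * damek (V0, Z0, t0) p = (t + t0) ^+ 2 + c.
  move=> tn0; have := @sigma_polyP (V0, Z0, t0) p (V0, Z0, t) tn0.
  rewrite q0 meval0 mulrBr => /esym/eqP; rewrite subr_eq0 => /eqP <-.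
  rewrite /= mulVKf// -/c /normsq subrr scaler0 /dot big1 ?addr0// => i _.
  by rewrite mxE mul0r.
have := E 1 (oner_neq0 _); have := E (-1); have := E 2; have := E (-2).
rewrite !oppr_eq0 oner_eq0 pnatr_eq0 => /(_ isT) e1 /(_ isT) e2 /(_ isT) e3 e4.
by move: e1 e2 e3 e4; nra.
Qed.

Definition sigma_eqn (x0 p : point) : quartic_equations :=
  pclass (sigma_poly_neq0 x0 p).

(* Only meaningful where [eta theta] is not a point at infinity. *)
Definition sigma (eta : rp1 R -> proj_closure) (p : half_space) (theta : rp1 R)
    : quartic_equations :=
  sigma_eqn (affine_coords (eta theta)) (sval p).

End DamekRicci.
Arguments point R n m : clear implicits.
Arguments half_space R n m : clear implicits.
Arguments proj_closure R n m : clear implicits.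

(* Main.v *)
Require Import Defs.
From mathcomp Require Import -(notations) mpoly.
From mathcomp Require Import all_boot all_order all_algebra.
From mathcomp Require Import boolp classical_sets functions reals topology.
From mathcomp Require Import normedtype.
From mathcomp Require Import ring lra.

Set Implicit Arguments.
Unset Strict Implicit.
Unset Printing Implicit Defensive.

Import Order.TTheory GRing.Theory Num.Theory.
Import numFieldNormedType.Exports.

Local Open Scope classical_set_scope.
Local Open Scope ring_scope.

(** When [z = 0] the factor [1 - s theta] cancels in the geodesic, and
    [tau := 2 theta / (1 - s theta)] becomes a natural parameter.  With
    [p = (Vb, Zb, tb)] and [k := sqrt tb], the point of [eta] of parameter
    [tau] is
<<
      V0 = Vb + k tau v,   Z0 = Zb + (k tau / 2) [Vb, v],
      t0 = tb (1 + s tau - |v|^2 tau^2 / 4)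
>>
    ([left_transl_geodesic]; the formula for [t0] is where
    [|v|^2 + s^2 = 1] enters).  In [t + t0 + |V - V0|^2 / 4] the two terms in
    [tau^2] cancel, so this quantity is affine in [tau], and so is
    [Z - Z0 + [V, V0] / 2].  Since moreover [D_(eta)(p) = tb (2 + s tau)^2]
    ([damek_pencil]), the equation of the hypersurface is a polynomial of
    degree 2 in [tau] with leading coefficient [tb / 4] times the limit
    equation ([sigma_poly_pencil]).

    The parameter [1 / s] of the projective line corresponds to
    [tau = infinity], that is, to [u = 0] for [u := 1 / tau].  Multiplied by
    the scalar [4 u^2 / tb], which does not change its class, the equation
    becomes [L + u B + u^2 D], with [L] the limit equation ([pencil]), and
    this tends to [L] with [u].  As [L] is not zero ([limit_poly_neq0]), the
    classes converge too.

    It remains to translate between convergence of classes and of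
    representatives.  The projection of the nonzero vectors onto a projective
    space is open, hence neighborhoods of a class are detected on
    representatives ([nbhs_pclass]).  This is used both in the target and in
    the projective line, near the representative [(1, s)] of [1 / s], where
    [u] is the function [(b - s a) / (2 a)] of the representative [(a, b)].
    A punctured neighborhood of [1 / s] can be taken to consist of numbers at
    which [chi] does not vanish, so that the formula for the geodesic
    applies. *)

(** * Neighborhoods in projective spaces *)

Section ProjectiveTopology.
Context {R : realType} {W : normedModType R}.
Local Open Scope quotient_scope.

(** The direct implication is the continuity of the projection; the converse
    is its openness, which holds because the saturation of an open set is the
    union of its images under the homotheties. *)
Lemma nbhs_pclass (w : W) (w0 : w != 0) (A : set (projective_space W)) :
  nbhs (pclass w0) A <->
  \forall x \near w, forall x0 : x != 0, A (pclass x0).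
Proof.
have setE (B : set (projective_space W)) : open B ->
    exists2 U, open U & forall x (x0 : x != 0), U x <-> B (pclass x0).
  move=> -[U oU UE]; exists U => // x x0.
  by rewrite /pclass -[B _]/((\pi_(projective_space W) @^-1` B) _) -UE.
split.
  rewrite {1}nbhsE => -[B [oB Bw] BA].
  have [U oU UB] := setE _ oB.
  have Uw : U w by apply/(UB _ w0).
  near=> x => x0; apply/BA/UB; near: x.
  exact: open_nbhs_nbhs.
move=> nbw; have : nbhs w [set x | forall x0 : x != 0, A (pclass x0)] by [].
rewrite nbhsE => -[U [oU Uw] UA]; rewrite nbhsE.
exists [set P | exists x (x0 : x != 0), U x /\ P = pclass x0]; last first.
  by move=> _ [x [x0 [Ux ->]]]; exact: UA.
split; last by exists w, w0.
exists (\bigcup_(c in [set c : R | c != 0]) ( *:%R c @^-1` U)).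
  apply: bigcup_open => c _; apply: open_comp => // x _.
  exact: scaler_continuous.
apply/seteqP; split=> x /=.
  move=> [c c0 Ucx].
  have x0 : set_val x != 0 by exact: (set_valP x).
  have cx0 : c *: set_val x != 0 by rewrite scaler_eq0 negb_or c0.
  exists (c *: set_val x), cx0; split => //.
  have -> : \pi_(projective_space W) x = pclass x0.
    by rewrite /pclass; congr (\pi_(projective_space W) _); exact/val_inj.
  by apply/pclass_eqP; exists c.
move=> [y [y0 [Uy]]].
have x0 : set_val x != 0 by exact: (set_valP x).
have -> : \pi_(projective_space W) x = pclass x0.
  by rewrite /pclass; congr (\pi_(projective_space W) _); exact/val_inj.
by move=> /pclass_eqP[c c0 ycx]; exists c => //=; rewrite -ycx.
Unshelve. all: by end_near. Qed.

End ProjectiveTopology.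

Lemma rp1_invE (R : realType) (s : R) (h : (1, s) != 0 :> R * R) :
  rp1_inv s = pclass h.
Proof.
rewrite /rp1_inv; case: eqVneq => s0; apply/pclass_eqP.
  by exists 1; rewrite ?oner_neq0// scale1r s0.
by exists s => //; congr pair; rewrite /= /GRing.scale/= ?mulfV// mulr1.
Qed.

Lemma rp1_ofE (R : realType) (q : R * R) (q0 : q != 0) :
  q.2 != 0 -> pclass q0 = rp1_of (q.1 / q.2).
Proof.
case: q q0 => a b q0 /= b0; apply/pclass_eqP; exists b^-1.
  by rewrite invr_eq0.
by congr pair; rewrite /= /GRing.scale/= ?mulVf// mulrC.
Qed.

(** * Scalar products and brackets, over the reals and over polynomials *)

Lemma dotC (K : comNzRingType) k (a b : 'rV[K]_k) : dot a b = dot b a.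
Proof. by apply: eq_bigr => i _; rewrite mulrC. Qed.

Lemma dotDl (K : comNzRingType) k (a b c : 'rV[K]_k) :
  dot (a + b) c = dot a c + dot b c.
Proof. by rewrite /dot -big_split; apply: eq_bigr => i _; rewrite mxE mulrDl. Qed.

Lemma dotZl (K : comNzRingType) k (x : K) (a c : 'rV[K]_k) :
  dot (x *: a) c = x * dot a c.
Proof. by rewrite /dot mulr_sumr; apply: eq_bigr => i _; rewrite mxE mulrA. Qed.

Lemma dotDr (K : comNzRingType) k (a b c : 'rV[K]_k) :
  dot a (b + c) = dot a b + dot a c.
Proof. by rewrite dotC dotDl !(dotC a). Qed.

Lemma dotZr (K : comNzRingType) k (x : K) (a c : 'rV[K]_k) :
  dot a (x *: c) = x * dot a c.
Proof. by rewrite dotC dotZl dotC. Qed.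

Lemma dot0l (K : comNzRingType) k (a : 'rV[K]_k) : dot 0 a = 0.
Proof. by rewrite -(scale0r 0) dotZl mul0r. Qed.

Lemma normsq0 (K : comNzRingType) k : normsq (0 : 'rV[K]_k) = 0.
Proof. exact: dot0l. Qed.

Lemma normsqD (K : comNzRingType) k (a b : 'rV[K]_k) :
  normsq (a + b) = normsq a + 2 * dot a b + normsq b.
Proof. by rewrite /normsq dotDl !dotDr (dotC b a); ring. Qed.

Lemma normsqZ (K : comNzRingType) k (x : K) (a : 'rV[K]_k) :
  normsq (x *: a) = x ^+ 2 * normsq a.
Proof. by rewrite /normsq dotZl dotZr; ring. Qed.

Lemma normsq_ge0 (R : realType) k (a : 'rV[R]_k) : 0 <= normsq a.
Proof. by apply: sumr_ge0 => i _; rewrite -expr2 sqr_ge0. Qed.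

Section Bracket.
Context {R : realType} {n m : nat} (J : clifford_module R n m).

Lemma normsq_cliff (Z : 'rV[R]_m) (V : 'rV[R]_n) :
  normsq (V *m J Z) = normsq Z * normsq V.
Proof.
have := cliff_norm J Z V; rewrite /enorm => /(congr1 (fun x => x ^+ 2)).
by rewrite exprMn !sqr_sqrtr ?normsq_ge0.
Qed.

(** The bracket is alternating because each [J_Z] is skew-symmetric.  Comparing
    the two values of [|J_Z (U + J_Z U)|^2], one given by the norm formula and
    the other by [J_Z^2 = - |Z|^2], yields [|Z|^2 <J_Z U, U> = 0]; the case
    [|Z| = 0] is treated apart, as then [J_Z U = 0]. *)
Lemma bracketV (U : 'rV[R]_n) : bracket J U U = 0.
Proof.
apply/esym/bracketP => Z; rewrite dot0l.
have [N0|N0] := eqVneq (normsq Z) 0.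
  have : normsq (U *m J Z) = 0 by rewrite normsq_cliff N0 mul0r.
  move=> /eqP; rewrite psumr_eq0 => [|i _]; last by rewrite -expr2 sqr_ge0.
  move=> /allP UJ0; apply/esym/big1 => i _; have := UJ0 i.
  by rewrite mem_index_enum -expr2 sqrf_eq0 => /(_ isT) /eqP ->; rewrite mul0r.
have := normsq_cliff Z (U + U *m J Z).
rewrite mulmxDl -mulmxA cliff_sqr !normsqD mul_mx_scalar normsqZ dotZr.
rewrite normsq_cliff -/(dot (U *m J Z) U) (dotC (U *m J Z) U) => e.
apply/esym/(mulfI N0); rewrite mulr0; move: e; lra.
Qed.

Lemma bracketDr (U V W : 'rV[R]_n) :
  bracket J U (V + W) = bracket J U V + bracket J U W.
Proof. by apply/rowP => k; rewrite !mxE dotDr. Qed.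

Lemma bracketZr c (U V : 'rV[R]_n) : bracket J U (c *: V) = c *: bracket J U V.
Proof. by apply/rowP => k; rewrite !mxE dotZr. Qed.

Local Notation poly := (mpoly (@nvars n m) R).
Local Notation C := (@mpolyC (@nvars n m) R).

Lemma bracket_polyDl (U V W : 'rV[poly]_n) :
  bracket_poly J (U + V) W = bracket_poly J U W + bracket_poly J V W.
Proof. by apply/rowP => k; rewrite !mxE mulmxDl dotDl. Qed.

Lemma bracket_polyDr (U V W : 'rV[poly]_n) :
  bracket_poly J U (V + W) = bracket_poly J U V + bracket_poly J U W.
Proof. by apply/rowP => k; rewrite !mxE dotDr. Qed.

Lemma bracket_polyZl c (U V : 'rV[poly]_n) :
  bracket_poly J (c *: U) V = c *: bracket_poly J U V.
Proof. by apply/rowP => k; rewrite !mxE -scalemxAl dotZl. Qed.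

Lemma bracket_polyZr c (U V : 'rV[poly]_n) :
  bracket_poly J U (c *: V) = c *: bracket_poly J U V.
Proof. by apply/rowP => k; rewrite !mxE dotZr. Qed.

Lemma dot_const k (U V : 'rV[R]_k) :
  dot (map_mx C U) (map_mx C V) = C (dot U V).
Proof. by rewrite /dot rmorph_sum; apply: eq_bigr => i _; rewrite !mxE rmorphM. Qed.

Lemma normsq_const k (U : 'rV[R]_k) : normsq (map_mx C U) = C (normsq U).
Proof. exact: dot_const. Qed.

Lemma bracket_poly_const (U V : 'rV[R]_n) :
  bracket_poly J (map_mx C U) (map_mx C V) = map_mx C (bracket J U V).
Proof.
apply/rowP => k; rewrite !mxE -dot_const; congr dot.
by rewrite map_mxM.
Qed.

End Bracket.

(** * The equations along the geodesic *)

(** The computation behind [sigma_poly_pencil].  It is carried out over an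
    arbitrary ring, in which half the square root of [tb] is named [h] and
    [c] is one half; [x] stands for the variable [t], and [W] and
    [M + (h tau) N] for [V - Vb] and [Z - Z0 + [V, V0] / 2]. *)
Lemma quartic_expansion (K : comNzRingType) a b (W w : 'rV[K]_a)
    (M N : 'rV[K]_b) (x s tau c h : K) : 2 * c = 1 ->
  let tb := 4 * h ^+ 2 in
  (x + (tb * (1 + s * tau) - (h * tau) ^+ 2 * normsq w)
     + normsq (c *: (W - (2 * h * tau) *: w))) ^+ 2
    + normsq (M + (h * tau) *: N) - tb * (2 + s * tau) ^+ 2 * x
  = (h * tau) ^+ 2
      * ((2 * s * (2 * h) - dot W w) ^+ 2 + normsq N - 4 * s ^+ 2 * x)
    + tau * (2 * (x + tb + normsq (c *: W)) * (s * tb - h * dot W w)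
             + 2 * h * dot M N - 4 * s * tb * x)
    + ((x + tb + normsq (c *: W)) ^+ 2 + normsq M - 4 * tb * x).
Proof.
move=> c2 tb; have -> : W = 2 *: (c *: W) by rewrite scalerA c2 scale1r.
move: (c *: W) => {}W.
have -> : c *: (2 *: W - (2 * h * tau) *: w) = W + (- (h * tau)) *: w.
  have -> : 2 * h * tau = 2 * (h * tau) by ring.
  by rewrite -scalerA -scalerBr scalerA mulrC c2 scale1r scaleNr.
have -> : c *: (2 *: W) = W by rewrite scalerA mulrC c2 scale1r.
rewrite !normsqD !normsqZ !dotZr dotZl /tb.
ring.
Qed.

Section Pencil.
Context {R : realType} {n m : nat} (J : clifford_module R n m).
Local Notation poly := (mpoly (@nvars n m) R).
Local Notation C := (@mpolyC (@nvars n m) R).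

(** The coefficients of [tau] and of [1] in the equation of the hypersurface,
    as a polynomial in [tau]. *)
Definition pencil_lin (v : 'rV[R]_n) (s : R) (p : Defs.point R n m) : poly :=
  let: (Vb, Zb, tb) := p in
  let W := varV - map_mx C Vb in
  2 * (vart + C tb + normsq (C 2^-1 *: W))
    * (C (s * tb) - C (Num.sqrt tb / 2) * dot W (map_mx C v))
  + C (Num.sqrt tb)
    * dot (varZ - map_mx C Zb + C 2^-1 *: bracket_poly J varV (map_mx C Vb))
        (bracket_poly J W (map_mx C v))
  - C (4 * s * tb) * vart.

Definition pencil_const (p : Defs.point R n m) : poly :=
  let: (Vb, Zb, tb) := p in
  (vart + C tb + normsq (C 2^-1 *: (varV - map_mx C Vb))) ^+ 2
  + normsq (varZ - map_mx C Zb
            + C 2^-1 *: bracket_poly J varV (map_mx C Vb))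
  - C (4 * tb) * vart.

(** As [1 / (1 - s theta) = 1 + s tau / 2], the height
    [(1 - theta^2) / (1 - s theta)^2] of the geodesic is
    [(1 + s tau / 2)^2 - tau^2 / 4], where [1 - s^2 = |v|^2]. *)
Lemma left_transl_geodesic (v : 'rV[R]_n) (s theta : R) (p : half_space R n m) :
  unit_vector v (0 : 'rV[R]_m) s -> s * theta != 1 ->
  let: (Vb, Zb, tb) := sval p in
  let tau := 2 * theta / (1 - s * theta) in
  left_transl J p (geodesic_param J v 0 s theta) =
  (Vb + (Num.sqrt tb * tau) *: v,
   Zb + (Num.sqrt tb * tau / 2) *: bracket J Vb v,
   tb * (1 + s * tau - normsq v * tau ^+ 2 / 4)).
Proof.
case: p => -[[Vb Zb] tb] /= tb0 + st1.
rewrite /unit_vector /geodesic_param /left_transl /chi /= normsq0 mul0r !addr0.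
rewrite linear0 mulmx0 !scaler0 !addr0 => hv.
have d0 : 1 - s * theta != 0 by rewrite subr_eq0 eq_sym.
have -> : normsq v = 1 - s ^+ 2 by rewrite -hv; ring.
rewrite bracketZr !scalerA; congr (_ + _ *: _, _ + _ *: _, _ * _); by field.
Qed.

(** The two terms in [tau^2] cancel, and the component in [z] vanishes since the
    bracket is alternating. *)
Lemma damek_pencil (v : 'rV[R]_n) (s tau : R) Vb Zb tb :
  0 < tb ->
  let k := Num.sqrt tb in
  damek J (Vb + (k * tau) *: v, Zb + (k * tau / 2) *: bracket J Vb v,
           tb * (1 + s * tau - normsq v * tau ^+ 2 / 4)) (Vb, Zb, tb)
  = tb * (2 + s * tau) ^+ 2.
Proof.
move=> tb0 k; rewrite /damek.
have -> : Vb - (Vb + (k * tau) *: v) = (- (k * tau)) *: v.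
  by rewrite opprD addNKr scaleNr.
have -> : Zb - (Zb + (k * tau / 2) *: bracket J Vb v)
    + 2^-1 *: bracket J Vb (Vb + (k * tau) *: v) = 0.
  rewrite bracketDr bracketV bracketZr add0r opprD addNKr scalerA addrC.
  by rewrite mulrC subrr.
rewrite normsq0 !normsqZ; have -> : (- (k * tau)) ^+ 2 = tb * tau ^+ 2.
  by rewrite sqrrN exprMn sqr_sqrtr// ltW.
by field; rewrite gt_eqF.
Qed.

(** With [t0] quadratic in [tau], the equation is a priori of degree 4; it has
    degree 2 because [t0 + |V - V0|^2 / 4] is affine in [tau]. *)
Lemma sigma_poly_pencil (v : 'rV[R]_n) (s tau : R) Vb Zb tb :
  0 < tb ->
  let k := Num.sqrt tb in
  let p := (Vb, Zb, tb) in
  sigma_poly J (Vb + (k * tau) *: v, Zb + (k * tau / 2) *: bracket J Vb v,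
     tb * (1 + s * tau - normsq v * tau ^+ 2 / 4)) p =
  C (tb / 4 * tau ^+ 2) * limit_poly J v s p
    + C tau * pencil_lin v s p + pencil_const p.
Proof.
move=> tb0 k p; rewrite /p /sigma_poly damek_pencil//.
rewrite /limit_poly /pencil_lin /pencil_const -/k {p}.
pose h := k / 2; have kE : k = 2 * h by rewrite /h; field.
have tbE : tb = 4 * h ^+ 2 by rewrite /h exprMn sqr_sqrtr ?ltW//; field.
clearbody h.
set W := varV - map_mx C Vb.
set M := varZ - map_mx C Zb + C 2^-1 *: bracket_poly J varV (map_mx C Vb).
set N := bracket_poly J W (map_mx C v).
have -> : varV - map_mx C (Vb + (k * tau) *: v)
    = W - (2 * C h * C tau) *: map_mx C v.
  by rewrite map_mxD map_mxZ opprD addrA kE !rmorphM rmorph_nat.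
have -> : varZ - map_mx C (Zb + (k * tau / 2) *: bracket J Vb v)
    + C 2^-1 *: bracket_poly J varV (map_mx C (Vb + (k * tau) *: v))
    = M + (C h * C tau) *: N.
  have -> : N = bracket_poly J varV (map_mx C v) - map_mx C (bracket J Vb v).
    rewrite /N /W bracket_polyDl -scaleN1r bracket_polyZl scaleN1r.
    by rewrite bracket_poly_const.
  have -> : k * tau / 2 = h * tau by rewrite kE; field.
  rewrite /M !map_mxD !map_mxZ bracket_polyDr bracket_polyZr !scalerDr scalerN.
  rewrite opprD scalerA -rmorphM; have -> : 2^-1 * (k * tau) = h * tau.
    by rewrite kE; field.
  rewrite -!rmorphM.
  move: (bracket_poly _ _ _) (bracket_poly _ _ _).
  move: (_ *: map_mx _ (bracket _ _ _)) (map_mx C Zb) varZ => c d e a b.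
  by rewrite addrA -!addrA; congr (_ + (_ + _)); rewrite [LHS]addrC -addrA.
clearbody W M N.
have c2 : 2 * C 2^-1 = 1 :> poly.
  by rewrite -(rmorph_nat C) -rmorphM mulfV ?rmorph1 ?pnatr_eq0.
have := quartic_expansion W (map_mx C v) M N vart (C s) (C tau) (C h) c2.
rewrite /= normsq_const => E.
have -> : tb * (1 + s * tau - normsq v * tau ^+ 2 / 4)
    = 4 * h ^+ 2 * (1 + s * tau) - (h * tau) ^+ 2 * normsq v.
  by rewrite tbE; field.
have -> : tb / 4 * tau ^+ 2 = (h * tau) ^+ 2 by rewrite tbE; field.
have -> : k / 2 = h by rewrite kE; field.
clearbody k; rewrite {}kE {}tbE.
rewrite !(rmorph1, rmorph_nat, rmorphXn, rmorphB, rmorphM, rmorphD).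
exact: E.
Qed.

End Pencil.

(** If [s != 0] the polynomial is nonzero at [(Vb, Zb, 2 tb)]; if [s = 0], then
    [|v| = 1] and it is nonzero at [(Vb + v, Zb, 1)]. *)
Lemma limit_poly_neq0 (R : realType) (n m : nat) (J : clifford_module R n m)
    (v : 'rV[R]_n) (s : R) (p : half_space R n m) :
  unit_vector v (0 : 'rV[R]_m) s -> limit_poly J v s (sval p) != 0.
Proof.
case: p => -[[Vb Zb] tb] /= tb0 hv; apply/eqP => L0.
have E V t : t != 0 ->
    t * (limit_lhs J v s (Vb, Zb, tb) (V, Zb, t) - 4 * s ^+ 2) = 0.
  move=> t0; have := @limit_polyP R n m J v s (Vb, Zb, tb) (V, Zb, t) t0.
  by rewrite (L0 : limit_poly J v s (Vb, Zb, tb) = 0) meval0 => <-.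
have [s0|s0] := eqVneq s 0.
  have := E (Vb + v) 1 (oner_neq0 _).
  rewrite /limit_lhs addrAC subrr add0r s0 bracketV.
  move: hv; rewrite /unit_vector s0 !normsq0 expr0n /= !addr0 -/(normsq v) => ->.
  by rewrite invr1; lra.
have tb2 : 2 * tb != 0 by rewrite mulf_neq0// gt_eqF.
have B0 : bracket J 0 v = 0.
  by apply/rowP => k; rewrite !mxE mul0mx dot0l.
have := E Vb (2 * tb) tb2.
rewrite /limit_lhs subrr B0 normsq0 dot0l subr0 addr0 !exprMn.
rewrite sqr_sqrtr; last exact: ltW.
have -> : 2 * tb * ((2 * tb)^-1 * (2 ^+ 2 * s ^+ 2 * tb) - 4 * s ^+ 2)
    = - 4 * (s ^+ 2 * tb) by field; rewrite gt_eqF.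
move/eqP; rewrite mulf_eq0 oppr_eq0 pnatr_eq0 mulf_eq0 expf_eq0/=.
by rewrite (negPf s0) gt_eqF.
Qed.

(** * Convergence of the equations *)

Section Coefs.
Context {R : realType} {n m : nat}.

Lemma quartic_coefsD (q r : mpoly (@nvars n m) R) :
  quartic_coefs (q + r) = quartic_coefs q + quartic_coefs r.
Proof. by apply/rowP => i; rewrite !mxE mcoeffD. Qed.

Lemma quartic_coefsCM c (q : mpoly (@nvars n m) R) :
  quartic_coefs (mpolyC _ c * q) = c *: quartic_coefs q.
Proof. by apply/rowP => i; rewrite !mxE mcoeffCM. Qed.

End Coefs.

(** The equation at [tau = 1 / u], multiplied by [4 u^2 / tb] so as to extend to
    [u = 0]. *)
Definition pencil (R : realType) (n m : nat) (J : clifford_module R n m)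
    (v : 'rV[R]_n) (s : R) (p : Defs.point R n m) (u : R) :
    'rV[R]_(@nmonomials n m) :=
  quartic_coefs (limit_poly J v s p)
  + u *: ((4 / p.2) *: quartic_coefs (pencil_lin J v s p))
  + u ^+ 2 *: ((4 / p.2) *: quartic_coefs (pencil_const J p)).

Lemma pencil_continuous (R : realType) (n m : nat) (J : clifford_module R n m)
    (v : 'rV[R]_n) (s : R) (p : Defs.point R n m) :
  continuous (pencil J v s p).
Proof.
move=> u; apply: cvgD.
  apply: cvgD; first exact: cvg_cst.
  by apply: cvgZr_tmp; exact: cvg_id.
apply: cvgZr_tmp; apply: (@cvgM _ _ (nbhs u) _ id id); exact: cvg_id.
Qed.

Lemma pencil_sigma_poly (R : realType) (n m : nat) (J : clifford_module R n m)
    (v : 'rV[R]_n) (s theta : R) (p : half_space R n m) :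
  unit_vector v (0 : 'rV[R]_m) s -> theta != 0 -> s * theta != 1 ->
  let u := (1 - s * theta) / (2 * theta) in
  pencil J v s (sval p) u = (4 * u ^+ 2 / (sval p).2) *:
    quartic_coefs (sigma_poly J
       (left_transl J p (geodesic_param J v 0 s theta)) (sval p)).
Proof.
move=> hv th0 st1 u.
have d0 : 1 - s * theta != 0 by rewrite subr_eq0 eq_sym.
have := left_transl_geodesic J p hv st1.
case: p => -[[Vb Zb] tb] tb0 E; rewrite E {E}.
rewrite -[sval (exist _ _ _)]/(Vb, Zb, tb) sigma_poly_pencil//.
have -> : 2 * theta / (1 - s * theta) = u^-1 by rewrite invf_div.
have u0 : u != 0 by rewrite mulf_neq0 ?invr_eq0 ?mulf_neq0 ?pnatr_eq0.
rewrite /pencil -[(_, _).2]/tb.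
move: (limit_poly _ _ _ _) (pencil_lin _ _ _ _) (pencil_const _ _) => L B D.
rewrite !quartic_coefsD !quartic_coefsCM !scalerDr !scalerA.
have tbn0 : tb != 0 by rewrite gt_eqF.
have -> : 4 * u ^+ 2 / tb * (tb / 4 * u^-1 ^+ 2) = 1.
  by field; rewrite u0 tbn0.
have -> : 4 * u ^+ 2 / tb * u^-1 = u * (4 / tb).
  by field; rewrite u0 tbn0.
have -> : 4 * u ^+ 2 / tb = u ^+ 2 * (4 / tb) by field.
by rewrite scale1r.
Qed.

Theorem proposition8p1 (R : realType) (n m : nat) (J : clifford_module R n m)
    (v : 'rV[R]_n) (z : 'rV[R]_m) (s : R)
    (gamma : rp1 R -> proj_closure R n m) (p : half_space R n m) :
  unit_vector v z s ->
  is_prolongation J v z s gamma ->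
  z = 0 ->
  let eta := fun theta => proj_left_transl J p (gamma theta) in
  exists nontrivial : quartic_coefs (limit_poly J v s (sval p)) != 0,
    sigma J eta p theta @[theta --> (rp1_inv s)^'] --> pclass nontrivial.
Proof.
move=> + [_ gammaE] z0; rewrite {}z0 in gammaE * => hv eta.
have nontrivial : quartic_coefs (limit_poly J v s (sval p)) != 0.
  by apply: quartic_coefs_neq0 (size_limit_poly _ _ _ _) (limit_poly_neq0 J p hv).
exists nontrivial => A /nbhs_pclass nA.
have h1s : (1, s) != 0 :> R * R by apply/eqP => -[/eqP]; rewrite oner_eq0.
rewrite /fmap /= /dnbhs /within /= (rp1_invE h1s); apply/nbhs_pclass.
pose u (q : R * R) : R := (q.2 - s * q.1) / (2 * q.1).
have fst1 : fst @ nbhs ((1, s) : R * R) --> (1 : R) by exact: cvg_fst.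
have snds : snd @ nbhs ((1, s) : R * R) --> (s : R) by exact: cvg_snd.
have cu : u @ nbhs ((1, s) : R * R) --> (0 : R).
  have -> : 0 = (s - s * 1) / (2 * 1) by rewrite mulr1 subrr mul0r.
  apply: cvgM; first by apply: cvgB => //; apply: cvgM => //; exact: cvg_cst.
  apply: cvgV; first by rewrite mulr1 pnatr_eq0.
  by apply: cvgM => //; exact: cvg_cst.
have cpencil : pencil J v s (sval p) \o u @ nbhs ((1, s) : R * R)
    --> quartic_coefs (limit_poly J v s (sval p)).
  have -> : quartic_coefs (limit_poly J v s (sval p)) = pencil J v s (sval p) 0.
    by rewrite /pencil expr0n !scale0r !addr0.
  exact: (cvg_comp _ _ cu (@pencil_continuous _ _ _ J v s (sval p) 0)).
have n1 : \forall q \near ((1, s) : R * R), q.1 != 0.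
  apply: (fst1 [set a | a != 0]); apply: open_nbhs_nbhs.
  by split; [exact: open_neq|exact: oner_neq0].
have n2 : \forall q \near ((1, s) : R * R), s != 0 -> q.2 != 0.
  have [_|s0] := eqVneq s 0; first by near=> q.
  have : \forall q \near ((1, s) : R * R), q.2 != 0.
    apply: (snds [set b | b != 0]); apply: open_nbhs_nbhs.
    by split; [exact: open_neq|exact: s0].
  by apply: filterS => q.
near=> q => q0 Pq.
have q1 : q.1 != 0 by near: q.
have q2 : s != 0 -> q.2 != 0 by near: q.
have Aq : forall x0 : pencil J v s (sval p) (u q) != 0, A (pclass x0).
  by near: q; exact: (cpencil _ nA).
have {Pq} qs : q.2 != s * q.1.
  apply: contra Pq => /eqP qs; apply/eqP/esym/pclass_eqP; exists q.1 => //.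
  case: (q) qs => a b /= ->.
  by congr pair; rewrite /= /GRing.scale/= ?mulr1// mulrC.
(* If [s = 0], the point excluded from the neighborhood is the infinite one. *)
have {}q2 : q.2 != 0.
  by have [s0|//] := eqVneq s 0; move: qs; rewrite s0 mul0r.
rewrite (rp1_ofE q0 q2); set theta := q.1 / q.2.
have th0 : theta != 0 by rewrite mulf_neq0 ?invr_eq0.
have st1 : s * theta != 1.
  by apply: contra qs; rewrite mulrA -(inj_eq (mulIf q2)) mulfVK// mul1r eq_sym.
have uE : u q = (1 - s * theta) / (2 * theta).
  by rewrite /u /theta; field; rewrite q1 q2.
rewrite /sigma /eta /= gammaE; last first.
  by rewrite /chi normsq0 mul0r addr0 expf_eq0 /= subr_eq0 eq_sym.
rewrite proj_left_transl_embed embedK /sigma_eqn.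
have u0 : u q != 0.
  rewrite uE; apply: mulf_neq0; first by rewrite subr_eq0 eq_sym.
  by rewrite invr_eq0 mulf_neq0 ?pnatr_eq0.
have c0 : 4 * (u q) ^+ 2 / (sval p).2 != 0.
  apply: mulf_neq0; first by rewrite mulf_neq0 ?pnatr_eq0// expf_neq0.
  by rewrite invr_eq0 gt_eqF// (valP p).
have := pencil_sigma_poly J p hv th0 st1; rewrite -uE => pE.
have pn0 : pencil J v s (sval p) (u q) != 0.
  by rewrite pE scaler_eq0 negb_or c0 sigma_poly_neq0.
rewrite (_ : pclass _ = pclass pn0); first exact: Aq.
by apply/pclass_eqP; exists (4 * u q ^+ 2 / (sval p).2).
Unshelve. all: by end_near. Qed.
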